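(* Let $X$ be a separable infinite-dimensional Banach space and let $\mathcal{A}=\bigcup_{\delta\in D}\mathcal{A}_\delta$ be an upper Furstenberg family satisfying: (1) for every $\delta'\in D$ there exists $\delta\in D$ such that for every $k\geq0$ and every $A\subseteq\mathbb{N}$: $A\in\mathcal{A}_{\delta'}$ implies $A-k\in\mathcal{A}_{\delta}$; (2) for every $A\in\mathcal{A}$ there exists $\delta\in D$ such that $\{k\geq0:\ A\cap(A-k)\in\mathcal{A}_{\delta}\}$ has bounded gaps. Let $T$ be a bounded linear operator on $X$. If $T$ is $\mathcal{A}$-hypercyclic, then $T\times T$ is $\mathcal{A}$-hypercyclic.
   Context: $\mathbb{N}=\{0,1,2,\dots\}$; for $A\subseteq\mathbb{N}$ and $k\ge0$, $A-k=\{m\in\mathbb{N}: m+k\in A\}$. A set $K\subseteq\mathbb{N}$ has bounded gaps if there is $L\ge1$ such that every interval of $L$ consecutive non-negative integers meets $K$. A non-empty family $\mathcal{A}$ of subsets of $\mathbb{N}$ is a Furstenberg family if $\emptyset\notin\mathcal{A}$ and $A\in\mathcal{A}$, $A\subset B\subseteq\mathbb N$ imply $B\in\mathcal{A}$. It is an upper Furstenberg family if in addition it can be written as $\mathcal{A}=\bigcup_{\delta\in D}\mathcal{A}_\delta$ with $\mathcal{A}_\delta=\bigcap_{\mu\in M}\mathcal{A}_{\delta,\mu}$ for some families $\mathcal{A}_{\delta,\mu}$ of subsets of $\mathbb N$ ($\delta\in D$, $\mu\in M$), where $D$ is arbitrary, $M$ is countable, and: (i) for any $A\in\mathcal{A}_{\delta,\mu}$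 there is a finite set $F\subset\mathbb{N}$ such that $A\cap F\subset B$ implies $B\in\mathcal{A}_{\delta,\mu}$; (ii) for any $A\in\mathcal{A}$ there is some $\delta\in D$ such that $A-n\in\mathcal{A}_\delta$ for all $n\geq0$. Conditions (1) and (2) of the claim refer to such a fixed decomposition. A bounded operator $S$ on a Banach space $Y$ is $\mathcal{A}$-hypercyclic if there is $y\in Y$ such that $\{n\in\mathbb{N}:S^ny\in U\}\in\mathcal{A}$ for every non-empty open set $U\subseteq Y$. The operator $T\times T$ acts on $X\times X$ by $(x_1,x_2)\mapsto(Tx_1,Tx_2)$. *)

(* Defs.v *)
From HB Require Import structures.
From mathcomp Require Import all_boot all_order all_algebra.
From mathcomp Require Import all_classical all_reals all_analysis.
From mathcomp Require Import complex.

Set Implicit Arguments.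
Unset Strict Implicit.
Unset Printing Implicit Defensive.

Import Order.TTheory GRing.Theory Num.Theory.
Import numFieldNormedType.Exports.

Local Open Scope classical_set_scope.
Local Open Scope ring_scope.

Definition shift_down (A : set nat) (k : nat) : set nat :=
  [set m | A (m + k)%N].

Definition bounded_gaps (A : set nat) : Prop :=
  exists2 L : nat, (1 <= L)%N &
    forall n : nat, exists2 k : nat, (n <= k < n + L)%N & A k.

Definition furstenberg_family (A : set (set nat)) : Prop :=
  [/\ A !=set0, ~ A set0 & forall B C : set nat, A B -> B `<=` C -> A C].

Definition family_at (D M : Type) (F : D -> M -> set (set nat)) (delta : D) :
    set (set nat) :=
  \bigcap_mu F delta mu.

(* [A] is an upper Furstenberg family, as witnessed by the decomposition [F]. *)
Definition upper_furstenberg_family (D M : Type) (A : set (set nat))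
    (F : D -> M -> set (set nat)) : Prop :=
  [/\ furstenberg_family A,
      countable [set: M],
      A = \bigcup_delta family_at F delta,
      forall (delta : D) (mu : M) (B : set nat), F delta mu B ->
        exists2 S : set nat, finite_set S &
          forall C : set nat, B `&` S `<=` C -> F delta mu C
    & forall B : set nat, A B ->
        exists delta : D, forall n : nat, family_at F delta (shift_down B n)].

(* The scalar field of a Banach space is that of the reals or of the complex
   numbers. *)
Definition real_or_complex (R : realType) (K : numFieldType) : Prop :=
  K = (R : numFieldType) \/ K = (R[i] : numFieldType).

Definition separable (X : topologicalType) : Prop :=
  exists2 S : set X, countable S & dense S.

Definition infinite_dimensional (K : numFieldType) (X : lmodType K) : Prop :=
  ~ exists (n : nat) (e : 'I_n -> X),
      forall x : X, exists a : 'I_n -> K, x = \sum_(i < n) a i *: e i.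

Definition bounded_operator (K : numFieldType) (X Y : normedModType K)
    (T : {linear X -> Y}) : Prop :=
  exists M : K, forall x : X, `|T x| <= M * `|x|.

Definition family_hypercyclic (A : set (set nat)) (Y : topologicalType)
    (S : Y -> Y) : Prop :=
  exists y : Y, forall U : set Y, open U -> U !=set0 ->
    A [set n : nat | U (iter n S y)].

Definition product_map (X Y : Type) (S : X -> X) (T : Y -> Y) (p : X * Y) :
    X * Y :=
  (S p.1, T p.2).

(* Main.v *)
Require Import Defs.
From HB Require Import structures.
From mathcomp Require Import all_boot all_order all_algebra.
From mathcomp Require Import all_classical all_reals all_analysis.
From mathcomp Require Import complex.

Set Implicit Arguments.
Unset Strict Implicit.
Unset Printing Implicit Defensive.

Import Order.TTheory GRing.Theory Num.Theory.
Import numFieldNormedType.Exports.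

Local Open Scope classical_set_scope.
Local Open Scope ring_scope.

(** Let x be a vector whose visits to each nonempty open set V form a member
    of the family.  By the bounded gaps condition, common visits of x to V at
    times n and n + k exist for a set of k with bounded gaps, so V returns to
    itself with bounded gaps, and then (the map being transitive) every open set
    hits every other with bounded gaps.  For a linear map this forces more: the
    hitting times from U1 to U2 contain intervals of every length, whatever the
    nonempty open sets U1 and U2 are (thick_hitting_times), because a point of
    U1 sent near 0 can be added to a point near 0 sent into U2.

    Given nonempty open sets V1 and V2, choose j and an open V inside V1 with
    T^j V inside V2, and let B be the set of visits of x to V.  A long interval
    of hitting times from U1 to U2 contains some j + k for which B and its shift
    by k meet in a member of family_at F delta'.  Starting from a point of the
    orbit of x in U1 that is sent into U2 by T^(j + k), both coordinates return
    together to V1 and V2 along a shift of this member; the shift condition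
    gives one index delta for all U1 and U2 (product_returns).

    This is what a Baire category argument needs (family_hypercyclic_criterion):
    since each F delta mu only tests finitely many times, the pairs returning to
    V1 and V2 along a member of it form an open set, which is dense by the
    above, and countably many of these sets suffice because the space is
    separable and M is countable. *)

(** * Topology over real or complex scalars *)

(** The order of the complex numbers is only partial, so they are no
    archimedean ordered field in the usual sense; this form of the archimedean
    property holds for them too, a positive complex number being real. *)
Definition inverses_tend_to_0 (K : numFieldType) : Prop :=
  forall e : K, 0 < e -> exists n : nat, n.+1%:R^-1 < e.

Lemma real_or_complex_inverses_tend_to_0 (R : realType) (K : numFieldType) :
  real_or_complex R K -> inverses_tend_to_0 K.
Proof.
have real_case (a : R) : 0 < a -> exists n : nat, n.+1%:R^-1 < a.
  move=> a0; exists (Num.truncn a^-1).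
  by rewrite -ltf_pV2 ?posrE ?invr_gt0 // invrK truncnS_gt.
case=> -> //= e; rewrite ltcE /= => /andP[/eqP Ime /real_case[n ne]].
exists n; rewrite ltcE; case: e Ime ne => a b /= -> ne.
have -> : (n.+1%:R^-1 : R[i]) = (n.+1%:R^-1)%:C%C by rewrite fmorphV rmorph_nat.
by rewrite /= eqxx.
Qed.

Lemma bounded_operator_continuous (K : numFieldType) (X Y : normedModType K)
    (T : {linear X -> Y}) : bounded_operator T -> continuous T.
Proof.
move=> [M TM]; apply: bounded_linear_continuous; apply/linear_boundedP.
(* M may be negative, or not real, when X is trivial *)
exists `|M|; split; first exact: normr_real.
move=> r Mr x; apply: (@le_trans _ _ (`|M| * `|x|)).
  have Mx : 0 <= M * `|x| by apply: le_trans (TM x).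
  by rewrite (le_trans (TM x)) // -[X in X <= _](ger0_norm Mx) normrM normr_id.
by rewrite ler_wpM2r // ltW.
Qed.

Definition cauchy_complete (U : uniformType) : Prop :=
  forall F : set_system U, ProperFilter F -> cauchy F -> exists l : U, F --> l.

Lemma cauchy_complete_prod (U V : uniformType) :
  cauchy_complete U -> cauchy_complete V -> cauchy_complete (U * V)%type.
Proof.
move=> U_complete V_complete F FF Fc.
have [l1 F1] : exists l : U, (fst @ F) --> l.
  apply: (U_complete (fst @ F) _) => A entA.
  rewrite near_simpl -near2E near_map2.
  by apply: Fc; exists (A, setT);
    [split => //; exact: entourageT | move=> [[a b] [c d]] [/= ? ?];
     exists ((a, c), (b, d))].
have [l2 F2] : exists l : V, (snd @ F) --> l.
  apply: (V_complete (snd @ F) _) => A entA.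
  rewrite near_simpl -near2E near_map2.
  by apply: Fc; exists (setT, A);
    [split => //; exact: entourageT | move=> [[a b] [c d]] [/= ? ?];
     exists ((a, c), (b, d))].
exists (l1, l2) => B [[B1 B2] [/= B1l B2l] B12].
have E1 : F [set p | B1 p.1] by exact: F1.
have E2 : F [set p | B2 p.2] by exact: F2.
by apply: filterS (filterI E1 E2) => p /= p12; exact: B12.
Qed.

(** Baire's theorem, by shrinking balls.  The double of each new ball lies in
    the previous one; this takes the place of closed balls, since the limit of
    the centres belongs to every doubled ball. *)
Lemma baire (K : numFieldType) (Y : pseudoMetricType K)
    (Y_complete : cauchy_complete Y) (K_arch : inverses_tend_to_0 K)
    (O : nat -> set Y) :
  (forall n, open (O n)) -> (forall n, dense (O n)) -> dense (\bigcap_n O n).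
Proof.
move=> oO dO U [a0 Ua0] oU.
pose P (n : nat) (b c : Y * {posnum K}) :=
  ball c.1 (2 * c.2%:num) `<=` ball b.1 b.2%:num `&` O n /\
  c.2%:num < n.+1%:R^-1.
have step (nb : nat * (Y * {posnum K})) : exists c, P nb.1 nb.2 c.
  case: nb => n [b r] /=.
  have [a [ba Oa]] : (interior (ball b r%:num) `&` O n) !=set0.
    apply: dO; last exact: open_interior.
    by exists b; exact: nbhsx_ballx.
  have /nbhs_ballP[e /= e0 ae] : nbhs a (ball b r%:num `&` O n).
    by apply: filterI => //; exact: open_nbhs_nbhs.
  have n20 : 0 < n.+2%:R^-1 :> K by rewrite invr_gt0.
  have e20 : 0 < e / 2 by rewrite divr_gt0.
  exists (a, Num.min (PosNum e20) (PosNum n20)); split => /=.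
    apply: subset_trans ae; apply: le_ball.
    rewrite -ler_pdivlMl // [leRHS]mulrC.
    change (e / 2) with (PosNum e20)%:num.
    by rewrite num_le ge_min lexx.
  apply: (@le_lt_trans _ _ (PosNum n20)%:num).
    by rewrite num_le ge_min lexx orbT.
  by rewrite /= ltf_pV2 ?posrE // ltr_nat.
have [f Pf] := choice step.
have /nbhs_ballP[e0 /= e00 Ue0] : nbhs a0 U by exact: open_nbhs_nbhs.
have e020 : 0 < e0 / 2 by rewrite divr_gt0.
pose fix c n := if n is m.+1 then f (m, c m) else (a0, PosNum e020).
have Pc n : P n (c n) (c n.+1) by exact: (Pf (n, c n)).
have shrink n : ball (c n.+1).1 (c n.+1).2%:num `<=` ball (c n).1 (c n).2%:num.
  have [sub _] := Pc n.
  apply: (subset_trans (le_ball _)) (subset_trans sub (@subIsetl _ _ _)).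
  by rewrite ler_peMl // ler1n.
have nested n m : (n <= m)%N ->
    ball (c m).1 (c m).2%:num `<=` ball (c n).1 (c n).2%:num.
  elim: m => [|m IH]; first by rewrite leqn0 => /eqP ->.
  rewrite leq_eqVlt => /orP[/eqP -> //|nm].
  exact: subset_trans (shrink m) (IH nm).
have centre n m : (n <= m)%N -> ball (c n).1 (c n).2%:num (c m).1.
  by move=> /nested; apply; exact: ballxx.
have [l cl] : exists l : Y, (fst \o c) @ \oo --> l.
  apply: Y_complete; apply: cauchy_exP => e e_gt0.
  have [n ne] := K_arch e e_gt0; exists (c n.+1).1.
  exists n.+1 => // m /= nm; apply: le_ball (centre _ _ nm).
  by have [_ lt] := Pc n; exact: ltW (lt_trans lt ne).
have lc n : ball (c n).1 (2 * (c n).2%:num) l.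
  have /cl[N _ Nl] : nbhs l (ball l (c n).2%:num) by exact: nbhsx_ballx.
  have := Nl (maxn n N) (leq_maxr _ _) => /= /ball_sym lm.
  rewrite mulrDl mul1r.
  exact: ball_triangle (centre _ _ (leq_maxl n N)) lm.
exists l; split; last by move=> n _; have [sub _] := Pc n; have [] := sub _ (lc _).
apply: Ue0; have := lc 0%N.
by rewrite /= mulrC divfK.
Qed.

Lemma baire_countable (K : numFieldType) (Y : pseudoMetricType K)
    (Y_complete : cauchy_complete Y) (K_arch : inverses_tend_to_0 K)
    (I : Type) (J : set I) (O : I -> set Y) :
  countable J -> (forall i, J i -> open (O i)) ->
  (forall i, J i -> dense (O i)) -> dense (\bigcap_(i in J) O i).
Proof.
move=> /countable_injP[f f_inj] oO dO.
pose Q n := \bigcap_(i in J `&` [set i | f i = n]) O i.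
have Q_cases n : Q n = setT \/ exists2 i, J i & Q n = O i.
  have [[i [Ji fi]]|noi] := pselect (exists i, J i /\ f i = n); [right|left].
    exists i => //; apply/seteqP; split => [y Qy|y Oy j [Jj fj]]; first exact: Qy.
    by have -> : j = i by apply: f_inj; rewrite ?inE // fj.
  by apply/seteqP; split => // y _ i [Ji fi]; case: noi; exists i.
have -> : \bigcap_(i in J) O i = \bigcap_n Q n.
  apply/seteqP; split => [y Oy n _ i [Ji _]|y Qy i Ji]; first exact: Oy.
  exact: (Qy (f i)).
apply: (baire Y_complete K_arch) => n; have [->|[i Ji ->]] := Q_cases n.
- exact: openT.
- exact: oO.
- by move=> U U0 _; rewrite setIT.
- exact: dO.
Qed.

(** The interiors of the balls of radius 1/(n+1) around the points of a
    countable dense set form a basis. *)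
Lemma separable_second_countable (K : numFieldType) (Y : pseudoMetricType K)
    (K_arch : inverses_tend_to_0 K) :
  separable Y -> @second_countable Y.
Proof.
move=> [S Sc Sd].
pose b (q : Y * nat) := interior (ball q.1 (q.2.+1%:R^-1 : K)).
exists (b @` (S `*` setT)).
  apply: sub_countable (card_image_le _ _) _.
  by apply: countableX => //; exact: countableP.
split => [_ [q _ <-]|y U Uy]; first exact: open_interior.
have /nbhs_ballP[e /= e0 Ue] := Uy.
have [|n ne] := K_arch (e / 2); first by rewrite divr_gt0.
set r : K := n.+1%:R^-1 in ne.
have r0 : 0 < r by rewrite invr_gt0.
have r20 : 0 < r / 2 by rewrite divr_gt0.
(* s is taken r/2-close to y, not just r-close, so that y is interior to the
   ball of radius r around s *)
have [s [ys Ss]] : (interior (ball y (r / 2)) `&` S) !=set0.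
  by apply: Sd; [exists y; exact: nbhsx_ballx | exact: open_interior].
have {}ys : ball y (r / 2) s by exact: interior_subset.
exists (b (s, n)); first split.
- by exists (s, n).
- apply/nbhs_ballP; exists (r / 2) => //= z yz.
  by rewrite [_^-1](splitr r); apply: ball_triangle yz; exact: ball_sym.
- move=> z /interior_subset /= sz; apply: Ue.
  apply: le_ball (ball_triangle ys sz).
  rewrite (splitr e); apply: lerD (ltW ne).
  by apply: le_trans (ltW ne); rewrite ler_pdivrMr // ler_peMr ?ler1n // ltW.
Qed.

Lemma open_setX (U V : topologicalType) (P : set U) (Q : set V) :
  open P -> open Q -> open (P `*` Q).
Proof.
move=> oP oQ; rewrite openE => -[u v] [/= Pu Qv].
by exists (P, Q) => //; split; exact: open_nbhs_nbhs.
Qed.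

Lemma nbhs_prod_open (U V : topologicalType) (w : U * V) (W : set (U * V)) :
  nbhs w W -> exists P Q,
    [/\ open P, P w.1, open Q, Q w.2 & P `*` Q `<=` W].
Proof.
case=> -[P Q] [/= /nbhs_interior Pw /nbhs_interior Qw] PQ.
exists (interior P), (interior Q); split; try exact: open_interior.
- exact: nbhs_singleton.
- exact: nbhs_singleton.
- by move=> p [/interior_subset ? /interior_subset ?]; exact: PQ.
Qed.

Lemma second_countable_prod (U V : topologicalType) :
  @second_countable U -> @second_countable V -> @second_countable (U * V)%type.
Proof.
move=> [B Bc [Bo Bn]] [C Cc [Co Cn]].
exists ((fun q : set U * set V => q.1 `*` q.2) @` (B `*` C)).
  by apply: sub_countable (card_image_le _ _) _; exact: countableX.
split => [_ [[P Q] [/= BP CQ] <-]|[u v] W [[P Q] [/= Pu Qv] PQW]].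
  by apply: open_setX; [exact: Bo|exact: Co].
have [P' [BP' P'u] P'P] := Bn u P Pu.
have [Q' [CQ' Q'v] Q'Q] := Cn v Q Qv.
exists (P' `*` Q'); first by split => //; exists (P', Q').
by move=> [a b] [/= /P'P Pa /Q'Q Qb]; exact: PQW.
Qed.

Lemma iter_continuous (Y : topologicalType) (S : Y -> Y) (n : nat) :
  continuous S -> continuous (iter n S).
Proof.
move=> cS; elim: n => [|n IH] y; first exact: cvg_id.
by apply: (@continuous_comp _ _ _ (iter n S) S); [exact: IH|exact: cS].
Qed.

Lemma open_bigcap_finite (Y : topologicalType) (I : choiceType) (J : set I)
    (O : I -> set Y) :
  finite_set J -> (forall i, J i -> open (O i)) -> open (\bigcap_(i in J) O i).
Proof.
move=> /finite_fsetP[J' ->] oO; rewrite openE => y Oy.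
apply: filter_bigI => i iJ'; apply: open_nbhs_nbhs; split; last exact: Oy.
exact: oO.
Qed.

(** * A Birkhoff-type criterion for upper Furstenberg families *)

Section Families.
Variables (D M : Type) (A : set (set nat)) (F : D -> M -> set (set nat)).
Hypothesis A_upper : upper_furstenberg_family A F.

Lemma family_atS (delta : D) (B C : set nat) :
  B `<=` C -> family_at F delta B -> family_at F delta C.
Proof.
have [_ _ _ F_fin _] := A_upper.
move=> BC FB mu _; have [S _] := F_fin _ _ _ (FB mu I); apply.
by move=> n [/BC].
Qed.

Lemma family_at_sub (delta : D) : family_at F delta `<=` A.
Proof. by have [_ _ -> _ _] := A_upper; move=> B FB; exists delta. Qed.

Lemma family_at_nonempty (delta : D) (B : set nat) :
  family_at F delta B -> B !=set0.
Proof.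
move=> /family_at_sub AB; apply/set0P/eqP => B0.
by have [[_ + _] _ _ _ _] := A_upper; apply; rewrite -B0.
Qed.

(** Membership in F delta mu is decided by finitely many return times, and
    each of them persists under small perturbations of the point. *)
Lemma open_return_set (Y : topologicalType) (S : Y -> Y) (V : set Y)
    (delta : D) (mu : M) :
  continuous S -> open V ->
  open [set y | F delta mu [set n | V (iter n S y)]].
Proof.
move=> cS oV; rewrite openE => y /= Fy.
have [_ _ _ F_fin _] := A_upper.
have [J Jfin JF] := F_fin _ _ _ Fy.
have oW : open (\bigcap_(n in [set n | V (iter n S y)] `&` J)
    (iter n S @^-1` V)).
  apply: open_bigcap_finite; first exact: finite_setIr.
  by move=> n _; apply: open_comp => // z _; exact: iter_continuous.
apply: filterS (open_nbhs_nbhs (conj oW _)); last by move=> n [].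
by move=> z Wz; apply: JF => n; exact: Wz.
Qed.

(** For V in a countable basis, with delta depending on V alone, the points
    whose return set to V belongs to F delta mu form a dense open set; by Baire
    some point lies in all of these countably many sets. *)
Lemma family_hypercyclic_criterion (K : numFieldType)
    (K_arch : inverses_tend_to_0 K)
    (Y : pseudoMetricType K) (S : Y -> Y) :
  cauchy_complete Y -> @second_countable Y -> [set: Y] !=set0 -> continuous S ->
  (forall V : set Y, open V -> V !=set0 -> exists delta : D,
     forall U : set Y, open U -> U !=set0 ->
       exists2 y, U y & family_at F delta [set n | V (iter n S y)]) ->
  family_hypercyclic A S.
Proof.
move=> Y_complete [B Bc [Bo Bn]] Y0 cS crit.
have [_ Mc _ _ _] := A_upper.
have /choice[d dP] : forall V, exists delta : D, open V -> V !=set0 ->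
    forall U : set Y, open U -> U !=set0 ->
      exists2 y, U y & family_at F delta [set n | V (iter n S y)].
  move=> V.
  have [[oV V0]|nV] := pselect (open V /\ V !=set0).
    by have [delta dV] := crit V oV V0; exists delta.
  (* crit serves here only to obtain some element of D *)
  have [delta _] := crit setT openT Y0.
  by exists delta => oV V0; case: nV.
pose J := [set q : set Y * M | B q.1 /\ q.1 !=set0].
have Jc : countable J.
  apply: (@sub_countable _ _ _ (B `*` [set: M])); last exact: countableX.
  by apply: subset_card_le => q [].
have G_dense : dense (\bigcap_(q in J)
    [set y | F (d q.1) q.2 [set n | q.1 (iter n S y)]]).
  apply: (baire_countable Y_complete K_arch Jc) => q [/Bo oq q0].
    exact: open_return_set.
  move=> U U0 oU; have [y Uy Fy] := dP _ oq q0 U oU U0.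
  by exists y; split => //; exact: Fy.
have [y [_ y_in]] := G_dense _ Y0 openT.
exists y => U oU [u Uu].
have [V [BV Vu] VU] := Bn u U (open_nbhs_nbhs (conj oU Uu)).
apply: (@family_at_sub (d V)); apply: (@family_atS _ [set n | V (iter n S y)]).
  by move=> n; exact: VU.
by move=> mu _; apply: (y_in (V, mu)); split => //; exists u.
Qed.
End Families.

(** * Thick hitting times *)

Definition hitting_times (Y : Type) (S : Y -> Y) (U V : set Y) : set nat :=
  [set n | exists2 y, U y & V (iter n S y)].

Definition topologically_transitive (Y : topologicalType) (S : Y -> Y) : Prop :=
  forall U V : set Y, open U -> U !=set0 -> open V -> V !=set0 ->
    hitting_times S U V !=set0.

(** If S^j takes a point of U into V, then any return to U `&` S^-j V at time
    k gives a hit from U to V at time j + k. *)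
Lemma bounded_gaps_hitting_times (Y : topologicalType) (S : Y -> Y) :
  continuous S -> topologically_transitive S ->
  (forall V : set Y, open V -> V !=set0 -> bounded_gaps (hitting_times S V V)) ->
  forall U V : set Y, open U -> U !=set0 -> open V -> V !=set0 ->
    bounded_gaps (hitting_times S U V).
Proof.
move=> cS tS recur U V oU U0 oV V0.
have [j [u Uu Vju]] := tS U V oU U0 oV V0.
have [||L L1 gap] := recur (U `&` iter j S @^-1` V).
- apply: openI => //; apply: open_comp => // z _; exact: iter_continuous.
- by exists u.
exists (L + j)%N => [|n]; first by rewrite addn_gt0 L1.
have [k /andP[nk kn] [y [Uy _] [_ Vy]]] := gap n.
exists (j + k)%N; last by exists y => //; rewrite iterD.
by rewrite (leq_trans nk (leq_addl _ _)) addnC addnA ltn_add2r.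
Qed.

Lemma open_addl_nbhs0 (K : numFieldType) (X : normedModType K) (U : set X)
    (u : X) :
  open U -> U u ->
  exists U' W : set X, [/\ open U', U' u, open W, W 0 &
    forall a b, U' a -> W b -> U (a + b)].
Proof.
move=> oU Uu.
have : nbhs (u, 0 : X) [set p : X * X | U (p.1 + p.2)].
  have U0 : nbhs (u + 0) U by rewrite addr0; exact: open_nbhs_nbhs.
  exact: (@add_continuous X (u, 0) U U0).
move=> /nbhs_prod_open[P [Q [oP Pu oQ Q0 PQ]]].
by exists P, Q; split => // a b Pa Qb; exact: (PQ (a, b)).
Qed.

Lemma iter_linear0 (K : numFieldType) (X : normedModType K) (T : {linear X -> X})
  n : iter n T 0 = 0.
Proof. by elim: n => //= n ->; rewrite linear0. Qed.

Lemma iter_linearD (K : numFieldType) (X : normedModType K) (T : {linear X -> X})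
  n a b : iter n T (a + b) = iter n T a + iter n T b.
Proof. by elim: n => //= n ->; rewrite linearD. Qed.

(** Linearity enters here: a point of U sent near 0 plus a point near 0 sent
    into V is a point of U sent into V.  Hitting times from U to a neighbourhood
    W of 0 contain long intervals, since points sent to the points that stay in
    W for m steps exist for each m; hitting times from W to V can be stretched
    backwards into long intervals, since a point that stays in W for L steps may
    be replaced by any of its first L iterates, and they do so with bounded
    gaps.  Hence some interval of the second kind lies inside a long interval of
    the first kind. *)
Lemma thick_hitting_times (K : numFieldType) (X : normedModType K)
    (T : {linear X -> X}) :
  continuous T -> topologically_transitive T ->
  (forall V : set X, open V -> V !=set0 -> bounded_gaps (hitting_times T V V)) ->
  forall (U V : set X) (L : nat), open U -> U !=set0 -> open V -> V !=set0 ->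
    exists n, forall i, (n <= i <= n + L)%N -> hitting_times T U V i.
Proof.
move=> cT tT recur U V L oU [u Uu] oV [v Vv].
have [U' [W1 [oU' U'u oW1 W10 UW1]]] := open_addl_nbhs0 oU Uu.
have [V' [W2 [oV' V'v oW2 W20 VW2]]] := open_addl_nbhs0 oV Vv.
(* W m: the points that stay near 0 during m steps *)
pose W m := \bigcap_(i in `I_m.+1) (iter i T @^-1` (W1 `&` W2)).
have oW m : open (W m).
  apply: open_bigcap_finite => // i _; apply: open_comp; last exact: openI.
  by move=> z _; exact: iter_continuous.
have W0 m : W m !=set0 by exists 0 => i _; rewrite /= iter_linear0.
have [G _ gap] := bounded_gaps_hitting_times cT tT recur (oW L) (W0 L) oV'
  (ex_intro _ v V'v).
(* G bounds the gaps of the hits from W L to V', so one of them, m, comes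
   at least L and at most L + G steps after n *)
have [n [a U'a Wna]] := tT U' (W (L + G)%N) oU' (ex_intro _ u U'u) (oW _) (W0 _).
have [m /andP[nm mn] [b WLb V'b]] := gap (n + L)%N.
exists (m - L)%N => i /andP[mi im].
have Lm : (L <= m)%N by apply: leq_trans nm; exact: leq_addl.
rewrite subnK // in im.
have ni : (n <= i)%N.
  by apply: leq_trans mi; rewrite leq_subRL // addnC.
pose c := iter (m - i) T b.
have Wa : (W1 `&` W2) (iter i T a).
  have := Wna (i - n)%N; rewrite /= -iterD subnK //; apply.
  rewrite ltnS leq_subLR addnA; apply: leq_trans im _; exact: ltnW.
have Wc : (W1 `&` W2) c.
  by apply: WLb; rewrite /= ltnS leq_subCl.
exists (a + c); first by apply: UW1 => //; case: Wc.
rewrite iter_linearD addrC; apply: VW2; last by case: Wa.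
by rewrite /c -iterD subnKC.
Qed.

Lemma iter_product_map (X Y : Type) (S : X -> X) (T : Y -> Y) n p :
  iter n (product_map S T) p = (iter n S p.1, iter n T p.2).
Proof. by elim: n => [|n /= ->] //; case: p. Qed.

Lemma product_map_continuous (X Y : topologicalType) (S : X -> X) (T : Y -> Y) :
  continuous S -> continuous T -> continuous (product_map S T).
Proof.
move=> cS cT [x y] W [[P Q] [/= Px Qy] PQW].
exists (S @^-1` P, T @^-1` Q); first by split; [exact: cS|exact: cT].
by move=> [a b] [/= Pa Qb]; exact: PQW.
Qed.

(** * Orbits of hypercyclic vectors *)

Section HypercyclicVector.
Variables (D M : Type) (A : set (set nat)) (F : D -> M -> set (set nat)).
Hypothesis A_upper : upper_furstenberg_family A F.
Hypothesis A_shift : forall delta' : D, exists delta : D,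
  forall (k : nat) (B : set nat),
    family_at F delta' B -> family_at F delta (shift_down B k).
Hypothesis A_gaps : forall B : set nat, A B -> exists delta : D,
  bounded_gaps [set k : nat | family_at F delta (B `&` shift_down B k)].
Variables (Y : topologicalType) (S : Y -> Y) (x : Y).
Hypothesis S_cont : continuous S.
Hypothesis x_hyper : forall U : set Y, open U -> U !=set0 ->
    A [set n : nat | U (iter n S x)].

(** A member of the family stays nonempty after any shift, so every open set
    is visited after every given time. *)
Lemma orbit_visits_late (a : nat) (V : set Y) : open V -> V !=set0 ->
  exists n, V (iter (n + a) S x).
Proof.
move=> oV V0; have [_ _ _ _ A_tail] := A_upper.
have [delta Fd] := A_tail _ (x_hyper oV V0).
have [n Vn] := family_at_nonempty A_upper (Fd a).
by exists n.
Qed.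

Lemma hypercyclic_transitive : topologically_transitive S.
Proof.
move=> U V oU U0 oV V0.
have [a Ua] := orbit_visits_late 0 oU U0.
have [n Vn] := orbit_visits_late (a + 0) oV V0.
by exists n, (iter (a + 0) S x) => //; rewrite -iterD.
Qed.

Lemma hypercyclic_recurrent (V : set Y) :
  open V -> V !=set0 -> bounded_gaps (hitting_times S V V).
Proof.
move=> oV V0; have [delta [L L1 gap]] := A_gaps (x_hyper oV V0).
exists L => // n; have [k nk Fk] := gap n; exists k => //.
have [m [Vm Vmk]] := family_at_nonempty A_upper Fk.
by exists (iter m S x) => //; rewrite -iterD addnC.
Qed.

(** The second point is taken on the orbit of the first one, j + k steps
    later.  With j sending part of V1 into V2, common visits of V at times m
    and m + k turn into visits of V1 and V2 at the same time; the times k for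
    which there are enough of them have bounded gaps, hence some j + k meets the
    thick set of hitting times from U1 to U2.  The starting time a of the first
    point depends on U1 and U2, but by the shift property delta does not depend
    on a. *)
Lemma product_returns
    (S_thick : forall (U V : set Y) (L : nat),
      open U -> U !=set0 -> open V -> V !=set0 ->
      exists n, forall i, (n <= i <= n + L)%N -> hitting_times S U V i)
    (V1 V2 : set Y) :
  open V1 -> V1 !=set0 -> open V2 -> V2 !=set0 ->
  exists delta : D, forall U1 U2 : set Y,
    open U1 -> U1 !=set0 -> open U2 -> U2 !=set0 ->
    exists y1 y2, [/\ U1 y1, U2 y2 &
      family_at F delta [set n | V1 (iter n S y1) /\ V2 (iter n S y2)]].
Proof.
move=> oV1 V10 oV2 V20.
have [j [v V1v V2v]] := hypercyclic_transitive oV1 V10 oV2 V20.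
pose V := V1 `&` iter j S @^-1` V2.
have oV : open V.
  by apply: openI => //; apply: open_comp => // z _; exact: iter_continuous.
have V0 : V !=set0 by exists v.
have [delta' [L _ gap]] := A_gaps (x_hyper oV V0).
have [delta shift] := A_shift delta'.
exists delta => U1 U2 oU1 U10 oU2 U20.
have [n thick] := S_thick U1 U2 (j + L)%N oU1 U10 oU2 U20.
have [k /andP[nk kn] Fk] := gap n.
have [|y U1y U2y] := thick (j + k)%N.
  rewrite (leq_trans nk (leq_addl _ _)) /= addnCA leq_add2l.
  exact: ltnW.
have [a [U1a U2a]] :
    exists a, U1 (iter a S x) /\ U2 (iter (j + k) S (iter a S x)).
  have [||a Wa] := @orbit_visits_late 0 (U1 `&` iter (j + k) S @^-1` U2).
  - by apply: openI => //; apply: open_comp => // z _; exact: iter_continuous.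
  - by exists y.
  by exists (a + 0)%N; case: Wa.
exists (iter a S x), (iter (j + k) S (iter a S x)); split => //.
apply: (family_atS A_upper _ (shift a _ Fk)) => m.
rewrite /shift_down /= -!iterD => -[[V1m _] [_ V2m]]; split => //.
by move: V2m; rewrite /= -!iterD [(m + (j + k) + a)%N]addnAC addnCA.
Qed.
End HypercyclicVector.

(** * Hypercyclicity of the product *)

Theorem theorem2p5 (R : realType) (K : numFieldType)
  (hK : real_or_complex R K)
  (X : completeNormedModType K)
  (X_separable : separable X)
  (X_infinite : infinite_dimensional X)
  (D M : Type) (A : set (set nat)) (F : D -> M -> set (set nat))
  (A_upper : upper_furstenberg_family A F)
  (A_shift : forall delta' : D, exists delta : D,
     forall (k : nat) (B : set nat),
       family_at F delta' B -> family_at F delta (shift_down B k))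
  (A_gaps : forall B : set nat, A B -> exists delta : D,
     bounded_gaps [set k : nat | family_at F delta (B `&` shift_down B k)])
  (T : {linear X -> X})
  (T_bounded : bounded_operator T)
  (T_hypercyclic : family_hypercyclic (Y := X) A T) :
  family_hypercyclic (Y := (X * X)%type) A (product_map T T).
Proof.
have K_arch := real_or_complex_inverses_tend_to_0 hK.
have cT := bounded_operator_continuous T_bounded.
have [x x_hyper] := T_hypercyclic.
have X_complete : cauchy_complete X.
  by move=> G GG /cauchy_cvg/cvg_ex.
have X_countable : @second_countable X.
  exact: (separable_second_countable K_arch).
apply: (@family_hypercyclic_criterion D M A F A_upper K K_arch
  (X * X)%type (product_map T T)).
- exact: cauchy_complete_prod.
- exact: second_countable_prod.
- by exists (0, 0).
- exact: product_map_continuous.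
move=> V oV [[v1 v2] Vv].
have [V1 [V2 [oV1 V1v oV2 V2v V12]]] :=
  nbhs_prod_open (open_nbhs_nbhs (conj oV Vv)).
have T_thick := thick_hitting_times cT (hypercyclic_transitive A_upper x_hyper)
  (hypercyclic_recurrent A_upper A_gaps x_hyper).
have [delta ret] := product_returns A_upper A_shift A_gaps cT x_hyper T_thick
  oV1 (ex_intro _ v1 V1v) oV2 (ex_intro _ v2 V2v).
exists delta => U oU [u Uu].
have [U1 [U2 [oU1 U1u oU2 U2u U12]]] :=
  nbhs_prod_open (open_nbhs_nbhs (conj oU Uu)).
have [y1 [y2 [U1y U2y Fy]]] := ret U1 U2 oU1 (ex_intro _ u.1 U1u) oU2
  (ex_intro _ u.2 U2u).
exists (y1, y2); first by exact: U12.
apply: (family_atS A_upper _ Fy) => n [V1n V2n].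
by rewrite /= iter_product_map; exact: V12.
Qed.
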